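(* Let $(M,g,N)\to(\overline M,\overline g)$ be a closed rigged null hypersurface, and let $\alpha$ be a nowhere vanishing smooth function on $M$ such that $$\stackrel{\star}{A}_\xi=\alpha A_N\quad\text{and}\quad 2\alpha\,\tau(\xi)+d\alpha(\xi)=0 .$$ Let $\phi$ be a nowhere vanishing smooth function that is constant on each leaf of the screen distribution, and put $\widetilde N=\phi N$ and $\widetilde\alpha=\alpha/\phi^2$. Let $\widetilde\xi$, $\stackrel{\star}{A}_{\widetilde\xi}$, $A_{\widetilde N}$, $\widetilde\tau$ be the rigged vector field, shape operators and rotation $1$-form associated with the null rigging $\widetilde N$. Then $$\stackrel{\star}{A}_{\widetilde\xi}=\widetilde\alpha\, A_{\widetilde N}\quad\text{and}\quad 2\widetilde\alpha\,\widetilde\tau(\widetilde\xi)+d\widetilde\alpha(\widetilde\xi)=0 .$$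
   Context: All manifolds are smooth and connected. $(\overline M,\overline g)$ is an $(n+1)$-dimensional semi-Riemannian manifold of index $q>0$ with Levi-Civita connection $\overline\nabla$. $M\subset\overline M$ is an embedded hypersurface with inclusion $x$, and $g=x^\star\overline g$ is degenerate at every point ($M$ is a null hypersurface). A null rigging for $M$ is a vector field $N$ on an open subset of $\overline M$ containing $M$ such that, for every $p\in M$, $N_p\notin T_pM$ and $N_p$ is lightlike (nonzero and $\overline g(N_p,N_p)=0$); $(M,g,N)$ is then called a rigged null hypersurface. Put $\overline\eta=\overline g(N,\cdot)$ and $\eta=x^\star\overline\eta$. The screen distribution is $\mathcal S(TM)=\ker\eta\subset TM$. The rigged vector field $\xi$ is the unique section of the radical bundle $TM^\perp=\{X\in TM: g(X,Y)=0\ \forall Y\in TM\}$ with $\overline g(\xi,N)=1$. One has $T\overline M|_M=TM\oplus\mathrm{span}(N)$. The induced connection $\nabla$ on $M$, the second fundamental form $B$, the shape operators $A_N,\stackrel{\star}{A}_\xi$ (with values in $\mathcal S(TM)$) and the rotation $1$-form $\tau$ are defined, for $X,Y\in\Gamma(TM)$, by $$\overline\nabla_XY=\nabla_XY+B(X,Y)N,\quad \overline\nabla_XN=-A_NX+\tau(X)N,\quad \nabla_X\xi=-\stackrel{\star}{A}_\xi X-\tau(X)\xi .$$ $(M,g,N)$ is closed if $d\eta=0$ on $M$; then $\mathcal S(TM)$ is integrable. The objects associated with another null rigging are defined by the same formulas (all objects are considered along $M$). *)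

(* Defs.v *)
From HB Require Import structures.
From mathcomp Require Import all_boot all_order all_algebra.
From mathcomp Require Import all_classical all_reals all_analysis.

Set Implicit Arguments.
Unset Strict Implicit.
Unset Printing Implicit Defensive.

Import Order.TTheory GRing.Theory Num.Theory.
Import numFieldNormedType.Exports.
Local Open Scope classical_set_scope.
Local Open Scope ring_scope.

(* Only used for open [A].  In finite dimension this is the usual C^k class:
   all iterated directional derivatives up to order k exist and are
   continuous. *)
Fixpoint Ck (R : realType) (V W : normedModType R) (k : nat)
    (A : set V) (f : V -> W) : Prop :=
  match k with
  | 0%N => forall a, A a -> {for a, continuous f}
  | k'.+1 => (forall a, A a -> differentiable f a) /\
             (forall v, Ck k' A (fun a => 'D_v f a))
  end.

Definition Cinfty (R : realType) (V W : normedModType R)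
    (A : set V) (f : V -> W) : Prop := forall k, Ck k A f.

(* A homeomorphism [fwd] from an open set [dom] of T onto an open set [cod] of
   R^n, with inverse [bwd]; both functions are junk outside dom and cod. *)
Record chart (R : realType) (n : nat) (T : topologicalType) := Chart {
  dom : set T;
  cod : set 'rV[R]_n;
  fwd : T -> 'rV[R]_n;
  bwd : 'rV[R]_n -> T;
  dom_open : open dom;
  cod_open : open cod;
  fwd_cod : forall p, dom p -> cod (fwd p);
  bwd_dom : forall a, cod a -> dom (bwd a);
  fwdK : forall p, dom p -> bwd (fwd p) = p;
  bwdK : forall a, cod a -> fwd (bwd a) = a;
  fwd_cont : forall p, dom p -> {for p, continuous fwd};
  bwd_cont : forall a, cod a -> {for a, continuous bwd} }.

(* [chart_at p] is a preferred chart around p; it is used only to represent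
   tangent vectors at p. *)
Record manifold (R : realType) (n : nat) := Manifold {
  carrier :> topologicalType;
  atlas : set (chart R n carrier);
  chart_at : carrier -> chart R n carrier;
  chart_at_atlas : forall p, atlas (chart_at p);
  chart_at_dom : forall p, dom (chart_at p) p;
  atlas_compat : forall c d, atlas c -> atlas d ->
    Cinfty (cod c `&` bwd c @^-1` dom d) (fwd d \o bwd c);
  man_hausdorff : hausdorff_space carrier;
  man_second_countable : @second_countable carrier;
  man_connected : connected [set: carrier];
  man_nonempty : [set: carrier] !=set0 }.

Definition smooth_on (R : realType) (n : nat) (M : manifold R n)
    (W : normedModType R) (O : set M) (f : M -> W) : Prop :=
  forall c, atlas c -> Cinfty (cod c `&` bwd c @^-1` O) (f \o bwd c).

Definition smooth_map (R : realType) (m n : nat)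
    (L : manifold R m) (M : manifold R n) (f : L -> M) : Prop :=
  continuous f /\
  forall c, atlas c -> smooth_on (f @^-1` dom c) (fwd c \o f).

(* A tangent vector at p is given by its components in the coordinate basis of
   the preferred chart [chart_at p]. *)
Definition tangent (R : realType) (n : nat) (M : manifold R n) (p : M) :
  vectType R := 'rV[R]_n.

(* The derivative v(f) at p; f may be vector-valued. *)
Definition ddir (R : realType) (n : nat) (M : manifold R n) (W : normedModType R)
    (p : M) (v : tangent p) (f : M -> W) : W :=
  'D_(v : 'rV[R]_n) (f \o bwd (chart_at p)) (fwd (chart_at p) p).

(* The components of v in an arbitrary chart c. *)
Definition coord (R : realType) (n : nat) (M : manifold R n)
    (c : chart R n M) (p : M) (v : tangent p) : 'rV[R]_n := ddir v (fwd c).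

Definition tmap (R : realType) (m n : nat) (L : manifold R m) (M : manifold R n)
    (f : L -> M) (p : L) (v : tangent p) : tangent (f p) :=
  ddir v (fwd (chart_at (f p)) \o f).

(* Smoothness on O of a section Y of the pullback bundle f^*TM. *)
Definition smooth_along (R : realType) (m n : nat)
    (L : manifold R m) (M : manifold R n) (f : L -> M) (O : set L)
    (Y : forall p : L, tangent (f p)) : Prop :=
  forall c, atlas c ->
    smooth_on (O `&` f @^-1` dom c) (fun p => coord c (Y p)).

Definition vector_field (R : realType) (n : nat) (M : manifold R n) : Type :=
  forall p : M, tangent p.

Definition smooth_vf (R : realType) (n : nat) (M : manifold R n)
    (O : set M) (X : vector_field M) : Prop := @smooth_along R n n M M id O X.

(* [X, Y]_p: its components are X(Y^k) - Y(X^k) in the coordinates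
   [chart_at p]. *)
Definition bracket (R : realType) (n : nat) (M : manifold R n)
    (X Y : vector_field M) : vector_field M := fun p =>
  ddir (X p) (fun q => coord (chart_at p) (Y q))
  - ddir (Y p) (fun q => coord (chart_at p) (X q)).

Definition bilinear_field (R : realType) (n : nat) (M : manifold R n) : Type :=
  forall p : M, tangent p -> tangent p -> R.

Definition negative_definite_on (R : realType) (n : nat) (M : manifold R n)
    (g : bilinear_field M) (p : M) (V : {vspace tangent p}) : Prop :=
  forall v, v \in V -> v != 0 -> g p v v < 0.

Record semi_riemannian (R : realType) (n q : nat) (M : manifold R n)
    (g : bilinear_field M) : Prop := SemiRiemannian {
  metric_linear : forall p (a : R) (u v w : tangent p),
    g p (a *: u + v) w = a * g p u w + g p v w;
  metric_sym : forall p (u v : tangent p), g p u v = g p v u;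
  metric_nondegenerate : forall p (u : tangent p),
    (forall v, g p u v = 0) -> u = 0;
  metric_smooth : forall (O : set M) (X Y : vector_field M), open O ->
    smooth_vf O X -> smooth_vf O Y ->
    smooth_on O (fun p => g p (X p) (Y p) : R^o);
  metric_index : forall p,
    (exists V : {vspace tangent p}, \dim V = q /\ negative_definite_on g V) /\
    (forall V : {vspace tangent p}, negative_definite_on g V ->
       (\dim V <= q)%N) }.

(* [D p v Y] is D_v Y at p.  Y is a total function, but the value is only
   meaningful if Y is smooth in a neighbourhood of p; locality follows from the
   Leibniz rule applied to a function that is 1 near p and 0 elsewhere. *)
Definition cov_op (R : realType) (m n : nat) (L : manifold R m)
    (M : manifold R n) (f : L -> M) : Type :=
  forall p : L, tangent p -> (forall r : L, tangent (f r)) -> tangent (f p).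

(* Connections on the pullback bundle f^*TM. *)
Record connection_along (R : realType) (m n : nat) (L : manifold R m)
    (M : manifold R n) (f : L -> M) (D : cov_op f) : Prop := ConnectionAlong {
  conn_linear : forall p (a : R) (u v : tangent p) Y,
    D p (a *: u + v) Y = a *: D p u Y + D p v Y;
  conn_add : forall (O : set L) p (v : tangent p) Y Z, open O -> O p ->
    smooth_along O Y -> smooth_along O Z ->
    D p v (fun r => Y r + Z r) = D p v Y + D p v Z;
  conn_leibniz : forall (O : set L) p (v : tangent p) (h : L -> R^o) Y,
    open O -> O p -> smooth_on O h -> smooth_along O Y ->
    D p v (fun r => (h r : R) *: Y r) = (ddir v h : R) *: Y p + (h p : R) *: D p v Y;
  conn_smooth : forall (O : set L) (X : vector_field L) Y, open O ->
    smooth_vf O X -> smooth_along O Y ->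
    smooth_along O (fun p => D p (X p) Y) }.

Record levi_civita (R : realType) (n : nat) (M : manifold R n)
    (g : bilinear_field M) (nab : @cov_op R n n M M id) : Prop := LeviCivita {
  lc_connection : connection_along nab;
  lc_torsion_free : forall (O : set M) p (X Y : vector_field M),
    open O -> O p -> smooth_vf O X -> smooth_vf O Y ->
    nab p (X p) Y - nab p (Y p) X = bracket X Y p;
  lc_metric : forall (O : set M) p (v : tangent p) (Y Z : vector_field M),
    open O -> O p -> smooth_vf O Y -> smooth_vf O Z ->
    ddir v (fun r => g r (Y r) (Z r) : R^o) =
    g p (nab p v Y) (Z p) + g p (Y p) (nab p v Z) }.

(* The (unique) connection on x^*TM induced by [nab]; it gives a meaning to
   nab_X Y for X tangent to L and Y a section of TM defined along L only. *)
Record pullback_connection (R : realType) (m n : nat) (L : manifold R m)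
    (M : manifold R n) (x : L -> M) (nab : @cov_op R n n M M id)
    (D : cov_op x) : Prop := PullbackConnection {
  pb_connection : connection_along D;
  pb_compat : forall (O : set M) p (v : tangent p) (Y : vector_field M),
    open O -> O (x p) -> smooth_vf O Y ->
    D p v (fun r => Y (x r)) = nab (x p) (tmap x v) Y }.

Definition immersion (R : realType) (m n : nat) (L : manifold R m)
    (M : manifold R n) (f : L -> M) : Prop :=
  smooth_map f /\ forall p, injective (@tmap R m n L M f p).

Definition embedding (R : realType) (m n : nat) (L : manifold R m)
    (M : manifold R n) (f : L -> M) : Prop :=
  [/\ immersion f, injective f &
      forall O : set L, open O -> exists2 O' : set M, open O' & O = f @^-1` O'].

Definition distribution (R : realType) (n : nat) (M : manifold R n) : Type :=
  forall p : M, set (tangent p).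

(* Connected integral manifolds, seen as subsets of M. *)
Definition integral_manifold (R : realType) (n : nat) (M : manifold R n)
    (S : distribution M) (F : set M) : Prop :=
  exists (m : nat) (L : manifold R m) (f : L -> M),
    [/\ immersion f, injective f,
        forall p, range (@tmap R m n L M f p) = S (f p) & range f = F].

Definition leaf (R : realType) (n : nat) (M : manifold R n)
    (S : distribution M) (F : set M) : Prop :=
  integral_manifold S F /\
  forall F', integral_manifold S F' -> F `<=` F' -> F' = F.

Section Rigging.
Variables (R : realType) (n : nat) (M : manifold R n) (Mb : manifold R n.+1).
Variables (gb : bilinear_field Mb) (x : M -> Mb).
Arguments gb : clear implicits.

Definition induced_metric : bilinear_field M :=
  fun p u v => gb (x p) (tmap x u) (tmap x v).

Definition radical : distribution M :=
  fun p => [set u | forall v, induced_metric u v = 0].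

Definition null_hypersurface : Prop :=
  embedding x /\ forall p : M, exists2 u : tangent p, radical u & u != 0.

Definition null_rigging (N : vector_field Mb) : Prop :=
  (exists U : set Mb, [/\ open U, range x `<=` U & smooth_vf U N]) /\
  forall p, [/\ ~ (exists v : tangent p, tmap x v = N (x p)),
                N (x p) != 0 & gb (x p) (N (x p)) (N (x p)) = 0].

Definition rig_form (N : vector_field Mb) (p : M) (v : tangent p) : R :=
  gb (x p) (N (x p)) (tmap x v).

Definition screen (N : vector_field Mb) : distribution M :=
  fun p => [set v | rig_form N v = 0].

(* d eta = 0, with
   d eta (X, Y) = X (eta Y) - Y (eta X) - eta [X, Y]. *)
Definition closed_rigging (N : vector_field Mb) : Prop :=
  forall (O : set M) p (X Y : vector_field M), open O -> O p ->
    smooth_vf O X -> smooth_vf O Y ->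
    (ddir (X p) (fun r => rig_form N (Y r) : R^o) : R)
    - (ddir (Y p) (fun r => rig_form N (X r) : R^o) : R)
    - rig_form N (bracket X Y p) = 0.

Definition rigged_field (N : vector_field Mb) (xi : vector_field M) : Prop :=
  smooth_vf setT xi /\
  forall p, radical (xi p) /\ gb (x p) (tmap x (xi p)) (N (x p)) = 1.

(* [D] stands for the Levi-Civita connection of Mb along x. *)
Record rigging_objects (D : cov_op x) (N : vector_field Mb)
    (xi : vector_field M) (nab : @cov_op R n n M M id) (B : bilinear_field M)
    (AN As : forall p : M, tangent p -> tangent p)
    (tau : forall p : M, tangent p -> R) : Prop := RiggingObjects {
  ro_rigged : rigged_field N xi;
  ro_gauss : forall (O : set M) p (v : tangent p) (Y : vector_field M),
    open O -> O p -> smooth_vf O Y ->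
    D p v (fun r => tmap x (Y r)) =
    tmap x (nab p v Y) + B p v (Y p) *: N (x p);
  ro_weingarten : forall p (v : tangent p),
    D p v (fun r => N (x r)) = - tmap x (AN p v) + tau p v *: N (x p);
  ro_xi : forall p (v : tangent p),
    nab p v xi = - As p v - tau p v *: xi p;
  ro_AN_screen : forall p (v : tangent p), screen N (AN p v);
  ro_As_screen : forall p (v : tangent p), screen N (As p v) }.

End Rigging.

(* Main.v *)
Require Import Defs.
From HB Require Import structures.
From mathcomp Require Import all_boot all_order all_algebra.
From mathcomp Require Import ring.
From mathcomp Require Import all_classical all_reals all_analysis.

Set Implicit Arguments.
Unset Strict Implicit.
Unset Printing Implicit Defensive.

Import Order.TTheory GRing.Theory Num.Theory.
Import numFieldNormedType.Exports.
Local Open Scope classical_set_scope.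
Local Open Scope ring_scope.

(* The radical is a line and the ambient metric is nondegenerate, so
   xi = phi * xit.  The Leibniz rule along the immersion, applied to
   phi * N and to phi * xit, then gives, after splitting into tangential and
   transversal parts,
     A_Nt = phi A_N,   taut = tau + dphi / phi,   As_xit = As_xi / phi,
   where dphi cancels in the last formula.  Both identities follow, the terms
   d phi(xit) cancelling in the second one.  The Leibniz rule
   applies once N o x and x_*(xit) are known to be smooth along x: the first by
   the chain rule in charts, the second because in charts x_*(xit) is the sum
   of the components of xit times the partial derivatives of x. *)

(** * Calculus of C^k maps on open sets *)

Section CkCalculus.
Context {R : realType}.
Implicit Types V W : normedModType R.

(** The first-order expansion of [f] at [a] is also one of [g], and [diff_unique] then identifies
    the two differentials. *)
Lemma near_eq_differentiable V W (f g : V -> W) (a : V) :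
  (\near a, f a = g a) -> differentiable f a -> differentiable g a.
Proof.
move=> fg df; have fga : f a = g a by exact: nbhs_singleton fg.
have dg : g \o shift a = cst (g a) + 'd f a +o_ 0 id.
  apply/eqaddoP => e e0; have /diff_locallyP[_ /eqaddoP/(_ e e0)] := df.
  have fg0 : \forall h \near (0 : V), f (h + a) = g (h + a).
    by have := fg; rewrite (near_shift 0) subr0.
  by apply: filterS2 fg0 => h fgh; rewrite !fctE /= -fga fgh.
apply/diff_locallyP; rewrite (diff_unique (diff_continuous df) dg); split => //.
exact: diff_continuous.
Qed.

(* A named constant, so that the bilinear structure has a head to hang on. *)
Definition scale_by W (k : R^o) (w : W) : W := (k : R) *: w.

Fact scale_by_is_bilinear W :
  bilinear_for
    (GRing.Scale.Law.clone _ _ *:%R _) (GRing.Scale.Law.clone _ _ *:%R _)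
    (@scale_by W).
Proof.
rewrite /scale_by; split=> [w|k] a y z /=.
  by rewrite scalerDl -scalerA.
by rewrite scalerDr !scalerA mulrC.
Qed.

HB.instance Definition _ W := bilinear_isBilinear.Build R R^o W W _ _
  (@scale_by W) (@scale_by_is_bilinear W).

(** The product rule is the chain rule for the pair [(k, w)] followed by a continuous bilinear
    map. *)
Lemma is_diff_scale V W (k : V -> R^o) (w : V -> W) a :
  differentiable k a -> differentiable w a ->
  is_diff a (fun b => (k b : R) *: w b)
    (fun v => (k a : R) *: 'd w a v + ('d k a v : R) *: w a).
Proof.
move=> dk dw.
have sc : continuous (fun p : R^o * W => @scale_by W p.1 p.2).
  exact: scale_continuous.
have ds := differentiable_bilin (f := @scale_by W) (k a, w a) sc.
have dp := differentiable_pair dk dw.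
have -> : (fun b => (k b : R) *: w b) =
  (fun p : R^o * W => @scale_by W p.1 p.2) \o (fun b => (k b, w b)) by [].
apply: DiffDef; first exact: differentiable_comp.
by rewrite diff_comp// diff_bilin// diff_pair.
Qed.

Lemma Ck_sub V W k (A B : set V) (f : V -> W) : A `<=` B -> Ck k B f -> Ck k A f.
Proof.
move=> AB; elim: k f => [|k IH] f /=; first by move=> cf a /AB/cf.
by case=> df ck; split=> [a /AB/df//|v]; exact/IH/ck.
Qed.

(** Since [A] is open, equality on [A] is equality of germs, so it passes to derivatives on [A] and
    the induction closes. *)
Lemma eq_Ck V W k (A : set V) (f g : V -> W) : open A ->
  (forall a, A a -> f a = g a) -> Ck k A f -> Ck k A g.
Proof.
move=> oA; have near_eq h1 h2 a : A a -> (forall a, A a -> h1 a = h2 a :> W) ->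
    \near a, h1 a = h2 a.
  by move=> Aa fg; apply: filterS (open_nbhs_nbhs (conj oA Aa)).
elim: k f g => [|k IH] f g fg /= => [cf a Aa|[df ck]].
  rewrite /prop_for /continuous_at -(fg a Aa); apply: cvg_trans (cf a Aa).
  exact/near_eq_cvg/near_eq.
split=> [a Aa|v].
  exact: near_eq_differentiable (near_eq _ _ _ Aa fg) (df _ Aa).
by apply: IH (ck v) => a Aa; exact/near_eq_derive/near_eq.
Qed.

Lemma CkW V W k (A : set V) (f : V -> W) : Ck k.+1 A f -> Ck k A f.
Proof.
elim: k f => [|k IH] f [df ck]; first by move=> a /df/differentiable_continuous.
by split=> // v; exact/IH/ck.
Qed.

Lemma Ck_cst V W k (A : set V) (c : W) : Ck k A (fun=> c).
Proof.
elim: k c => [|k IH] c; first by move=> a _; exact: cst_continuous.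
split=> [a _|v]; first exact: differentiable_cst.
by under eq_fun do rewrite derive_cst.
Qed.

Lemma CkD V W k (A : set V) (f g : V -> W) : open A ->
  Ck k A f -> Ck k A g -> Ck k A (fun a => f a + g a).
Proof.
move=> oA; elim: k f g => [|k IH] f g /= => [cf cg a Aa|[df cf] [dg cg]].
  exact: cvgD (cf _ Aa) (cg _ Aa).
split=> [a Aa|v]; first by apply: differentiableD; [exact: df|exact: dg].
apply: eq_Ck (IH _ _ (cf v) (cg v)) => // a Aa.
by rewrite (deriveD (diff_derivable (df _ Aa)) (diff_derivable (dg _ Aa))).
Qed.

Lemma Ck_sum V W k (A : set V) m (f : 'I_m -> V -> W) : open A ->
  (forall i, Ck k A (f i)) -> Ck k A (fun a => \sum_i f i a).
Proof.
move=> oA; elim: m f => [|m IH] f cf.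
  by under eq_fun do rewrite big_ord0; exact: Ck_cst.
by under eq_fun do rewrite big_ord_recl; apply: CkD => //; exact: IH.
Qed.

Lemma Ck_scale V W k (A : set V) (h : V -> R^o) (f : V -> W) : open A ->
  Ck k A h -> Ck k A f -> Ck k A (fun a => (h a : R) *: f a).
Proof.
move=> oA; elim: k h f => [|k IH] h f => [ch cf a Aa|[dh ch] [df cf]].
  exact: cvgZ (ch _ Aa) (cf _ Aa).
have dhf a : A a -> is_diff a (fun b => (h b : R) *: f b)
    (fun v => (h a : R) *: 'd f a v + ('d h a v : R) *: f a).
  by move=> Aa; apply: is_diff_scale; [exact: dh|exact: df].
split=> [a /dhf d|v]; first exact: ex_diff.
(* Each term of the product rule has one undifferentiated factor, which the induction takes at order
   [k]. *)
have ckh : Ck k A h by exact: CkW.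
have ckf : Ck k A f by exact: CkW.
apply: eq_Ck (CkD oA (IH _ _ ckh (cf v)) (IH _ _ (ch v) ckf)) => // a Aa.
have d := dhf a Aa.
rewrite !deriveE; [|exact: ex_diff|exact: dh|exact: df].
by rewrite diff_val.
Qed.

Lemma Ck_coord V m k (A : set V) (f : V -> 'rV[R]_m) i : open A ->
  Ck k A f -> Ck k A (fun a => f a 0 i : R^o).
Proof.
move=> oA; elim: k f => [|k IH] f => [cf a Aa|[df cf]].
  apply: (@continuous_comp _ _ _ f (fun u : 'rV[R]_m => u 0 i : R^o)).
    exact: cf.
  exact: coord_continuous.
split=> [a Aa|v].
  apply: (@differentiable_comp _ _ _ _ f (fun u : 'rV[R]_m => u 0 i : R^o)).
    exact: df.
  exact: differentiable_coord.
apply: eq_Ck (IH _ (cf v)) => // a Aa.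
by rewrite (derive_mx (diff_derivable (df _ Aa))) mxE.
Qed.

(** Trades a direction that varies with the point for the fixed basis directions, the kind that [Ck]
    speaks of. *)
Lemma derive_row m W (g : 'rV[R]_m -> W) a v : differentiable g a ->
  'D_v g a = \sum_i (v 0 i) *: 'D_(delta_mx 0 i) g a.
Proof.
move=> dg; rewrite deriveE// {1}(row_sum_delta v) linear_sum.
by apply: eq_bigr => i _; rewrite linearZ deriveE.
Qed.

Lemma derive_compE V V' W (f : V -> V') (g : V' -> W) a v :
  differentiable f a -> differentiable g (f a) ->
  'D_v (g \o f) a = 'D_('D_v f a) g (f a).
Proof.
move=> df dg; rewrite !deriveE//; last exact: differentiable_comp.
by rewrite diff_comp.
Qed.

Lemma Ck_comp V m W k (A : set V) (B : set 'rV[R]_m) (f : V -> 'rV[R]_m)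
    (g : 'rV[R]_m -> W) : open A ->
  (forall a, A a -> B (f a)) -> Ck k A f -> Ck k B g -> Ck k A (g \o f).
Proof.
move=> oA AB; elim: k f g AB => [|k IH] f g AB => [cf cg a Aa|cSf [dg cg]].
  by apply: continuous_comp; [exact: cf|exact/cg/AB].
have [df cf] := cSf.
split=> [a Aa|v]; first by apply: differentiable_comp; [exact: df|exact/dg/AB].
(* Chain rule: the components of ['D_v f] times the partial derivatives of [g] along [f]; the
   induction applies to the latter. *)
apply: (@eq_Ck _ _ _ _ (fun a => \sum_i ('D_v f a 0 i : R) *:
    ('D_(delta_mx 0 i) g \o f) a)) => // [a Aa|].
  have dfa := df _ Aa; have dga := dg _ (AB _ Aa).
  by rewrite (derive_compE v dfa dga) (derive_row _ dga).
apply: Ck_sum => // i; apply: Ck_scale => //.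
  exact: (Ck_coord i oA (cf v)).
exact: IH AB (CkW cSf) (cg _).
Qed.

End CkCalculus.

(** * Smooth functions, maps and sections read in charts *)

Section Charts.
Context {R : realType}.

Lemma open_chart_preimage n (T : topologicalType) (c : chart R n T) (O : set T) :
  open O -> open (cod c `&` bwd c @^-1` O).
Proof.
move=> oO; rewrite openE => a [ca Oa].
apply: filterI; first exact: open_nbhs_nbhs (conj (@cod_open _ _ _ c) ca).
by apply: (bwd_cont ca); exact: open_nbhs_nbhs.
Qed.

(** Turns an identity valid on a chart overlap into equality of germs, as needed to compare
    derivatives. *)
Lemma near_chart n (T : topologicalType) (c : chart R n T) (O : set T)
    (P : set 'rV[R]_n) a :
  open O -> (cod c `&` bwd c @^-1` O) a ->
  (forall b, cod c b -> O (bwd c b) -> P b) -> \forall b \near a, P b.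
Proof.
move=> oO Aa AP; have oA := open_chart_preimage (c := c) oO.
by apply: filterS (open_nbhs_nbhs (conj oA Aa)) => b [cb Ob]; exact: AP.
Qed.

Section SmoothFunctions.
Variables (n : nat) (M : manifold R n).

Lemma fwd_chart_preimage (c : chart R n M) (O : set M) p : dom c p -> O p ->
  (cod c `&` bwd c @^-1` O) (fwd c p).
Proof. by move=> cp Op; split; [exact: fwd_cod | rewrite /= fwdK]. Qed.

Lemma smooth_on_differentiable (W : normedModType R) (O : set M) (f : M -> W)
    c p : smooth_on O f -> atlas c -> dom c p -> O p ->
  differentiable (f \o bwd c) (fwd c p).
Proof.
by move=> sf ac cp Op; have [df _] := sf c ac 1%N; exact/df/fwd_chart_preimage.
Qed.

Lemma ddir_linear (W : normedModType R) (O : set M) (f : M -> W) p a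
    (u v : tangent p) : smooth_on O f -> O p ->
  ddir (a *: u + v) f = a *: ddir u f + ddir v f.
Proof.
move=> sf Op; have df := smooth_on_differentiable sf (chart_at_atlas p)
  (chart_at_dom p) Op.
by rewrite /ddir !deriveE// linearP.
Qed.

(** Near the point, [f \o bwd c] is [f \o bwd e] after the transition map, whose derivative sends
    the preferred components of [v] to those in [e]. *)
Lemma ddir_chart (W : normedModType R) (f : M -> W) e p (v : tangent p) :
  atlas e -> dom e p -> differentiable (f \o bwd e) (fwd e p) ->
  ddir v f = 'D_(Defs.coord e v : 'rV[R]_n) (f \o bwd e) (fwd e p).
Proof.
move=> ae ep df; rewrite /Defs.coord /ddir; set c := chart_at p.
have cp : dom c p := chart_at_dom p.
have A0 := fwd_chart_preimage cp ep.
have [/(_ _ A0) dt _] := atlas_compat (chart_at_atlas p) ae 1%N.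
have E : (fwd e \o bwd c) (fwd c p) = fwd e p by rewrite /= fwdK.
rewrite -[in RHS]E -derive_compE//; last by rewrite E.
apply: near_eq_derive.
apply: near_chart (@dom_open _ _ _ e) A0 _ => b _ eb /=.
by rewrite fwdK.
Qed.

End SmoothFunctions.

Section SmoothMaps.
Variables (m n : nat) (L : manifold R m) (M : manifold R n).

Lemma smooth_map_on (x : L -> M) c : smooth_map x -> atlas c ->
  smooth_on (x @^-1` dom c) (fwd c \o x).
Proof. by case=> _; exact. Qed.

Lemma open_smooth_preimage (x : L -> M) (O : set M) : smooth_map x -> open O ->
  open (x @^-1` O).
Proof. by case=> cx _; move: O; exact/continuousP. Qed.

(** The chain rule through the transition map from the preferred chart at [x p] to [c] removes the
    choice made in [tmap]. *)
Lemma coord_tmap (x : L -> M) c p (v : tangent p) : smooth_map x -> atlas c ->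
  dom c (x p) -> Defs.coord c (tmap x v) = ddir v (fwd c \o x).
Proof.
move=> sx ac cp; rewrite /Defs.coord /tmap /ddir.
set c' := chart_at (x p); set e := chart_at p.
have c'p : dom c' (x p) := chart_at_dom (x p).
have ep : dom e p := chart_at_dom p.
have dx := smooth_on_differentiable (smooth_map_on sx (chart_at_atlas (x p)))
  (chart_at_atlas p) ep c'p.
have A0 := fwd_chart_preimage c'p cp.
have [/(_ _ A0) dt _] := atlas_compat (chart_at_atlas (x p)) ac 1%N.
have E : ((fwd c' \o x) \o bwd e) (fwd e p) = fwd c' (x p) by rewrite /= fwdK.
rewrite -E -derive_compE//; last by rewrite E.
apply: near_eq_derive.
apply: near_chart (open_smooth_preimage sx (@dom_open _ _ _ c'))
  (fwd_chart_preimage ep c'p) _ => b _ eb /=.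
by rewrite fwdK.
Qed.

Lemma tmap_linear (x : L -> M) p a (u v : tangent p) : smooth_map x ->
  tmap x (a *: u + v) = a *: tmap x u + tmap x v :> 'rV[R]_n.
Proof.
move=> sx; apply: ddir_linear (smooth_map_on sx (chart_at_atlas (x p))) _.
exact: chart_at_dom.
Qed.

Lemma smooth_along_comp (x : L -> M) (U : set M) (Y : vector_field M) :
  smooth_map x -> open U -> smooth_vf U Y ->
  smooth_along (x @^-1` U) (fun p => Y (x p)).
Proof.
move=> sx oU sY c ac e ae k.
have oA : open (cod e `&` bwd e @^-1` (x @^-1` U `&` x @^-1` dom c)).
  by apply: open_chart_preimage; apply: openI;
    apply: open_smooth_preimage => //; exact: dom_open.
have := smooth_map_on sx ac ae k.
move/(@Ck_sub R _ _ k (cod e `&` bwd e @^-1` (x @^-1` U `&` x @^-1` dom c))).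
have sub : cod e `&` bwd e @^-1` (x @^-1` U `&` x @^-1` dom c) `<=`
  cod e `&` bwd e @^-1` (x @^-1` dom c) by move=> a [? []].
move=> /(_ sub) cx.
(* The same chart [c] serves twice: for the components of [Y] and for its base point. *)
apply: eq_Ck (Ck_comp oA _ cx (sY c ac c ac k)) => //.
  by move=> a [ea [Ua ca]] /=; rewrite fwdK.
move=> a [ea [Ua ca]]; split; first exact: fwd_cod.
by rewrite /preimage /= fwdK.
Qed.

Lemma smooth_along_tmap (x : L -> M) (O : set L) (X : vector_field L) :
  smooth_map x -> open O -> smooth_vf O X ->
  smooth_along O (fun p => tmap x (X p)).
Proof.
move=> sx oO sX c ac e ae k.
set A := cod e `&` _.
have oA : open A.
  apply: open_chart_preimage; apply: openI => //.
  by apply: open_smooth_preimage => //; exact: dom_open.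
(* One order more for [x], because the pushforward involves its first derivatives. *)
have cx : Ck k.+1 A ((fwd c \o x) \o bwd e).
  by apply: Ck_sub (smooth_map_on sx ac ae k.+1) => a [? []].
have cX : Ck k A ((fun p => Defs.coord e (X p)) \o bwd e).
  apply: Ck_sub (sX e ae e ae k) => a [? []].
  by split=> //; split=> //; exact: bwd_dom.
have [dx c1x] := cx.
apply: (@eq_Ck R _ _ _ _ (fun a => \sum_i
    (Defs.coord e (X (bwd e a)) 0 i : R) *:
    'D_(delta_mx 0 i) ((fwd c \o x) \o bwd e) a)) => // [a Aa|].
  have [ea [Oa ca]] := Aa.
  have da := dx _ Aa.
  rewrite -(derive_row _ da) /= coord_tmap//.
  have eb : dom e (bwd e a) by exact: bwd_dom.
  by rewrite (ddir_chart _ ae eb) bwdK.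
apply: Ck_sum => // i; apply: Ck_scale => //; last exact: c1x.
exact: (Ck_coord i oA cX).
Qed.

End SmoothMaps.

End Charts.

(** * Splitting of the ambient tangent space into tangential and transversal parts *)

Lemma hyperplane_span (F : fieldType) n (f : {linear 'rV[F]_n -> 'rV[F]_n.+1})
    (w z : 'rV[F]_n.+1) :
  injective f -> ~ (exists u, f u = w) -> exists u a, z = f u + a *: w.
Proof.
move=> fI wf; pose A := col_mx (lin1_mx f) w.
(* [A] is square of size n + 1, so independence of its rows makes them span. *)
have free : row_free A.
  apply/inj_row_free => d.
  rewrite -[d]hsubmxK mul_row_col mul_rV_lin1 [rsubmx d]mx11_scalar mul_scalar_mx.
  set u := lsubmx d; set a := _ 0 0 => E.
  have a0 : a = 0.
    (* A nonzero coefficient of [w] would put [w] in the image of [f]. *)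
    apply/eqP/negP => /negP an0; apply: wf; exists (- a^-1 *: u).
    rewrite linearZ /= (_ : f u = - (a *: w)); last first.
      by apply/eqP; rewrite -addr_eq0 E.
    by rewrite scaleNr scalerN opprK scalerA mulVf// scale1r.
  have u0 : u = 0.
    by apply: fI; rewrite linear0; move: E; rewrite a0 scale0r addr0.
  by rewrite a0 u0 raddf0 row_mx0.
have /submxP[d ->] : (z <= A)%MS.
  by apply: submx_full; rewrite /row_full (eqP free) addn1.
exists (lsubmx d), (rsubmx d 0 0).
by rewrite -{1}[d]hsubmxK mul_row_col mul_rV_lin1 [rsubmx d]mx11_scalar
  mul_scalar_mx !mxE.
Qed.

Section Rigging.
Context {R : realType} {n q : nat}.
Variables (Mb : manifold R n.+1) (gb : bilinear_field Mb).
Variables (M : manifold R n) (x : M -> Mb).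
Arguments gb : clear implicits.
Hypothesis hM : null_hypersurface gb x.

Let sx : smooth_map x.
Proof. by have [[[]]] := hM. Qed.

Let tmap_inj p : injective (@tmap R n n.+1 M Mb x p).
Proof. by have [[[]]] := hM. Qed.

Let tmapZ p a (u : tangent p) : tmap x (a *: u) = a *: tmap x u.
Proof.
have tm0 : tmap x (0 : tangent p) = 0.
  (* Taking the scalar -1 and two zero vectors yields the value at 0; the same device recurs for the
     metric and for [D]. *)
  have := tmap_linear (-1) (0 : tangent p) 0 sx.
  by rewrite scaler0 addr0 scaleN1r addNr.
have := tmap_linear a u 0 sx.
by rewrite addr0 tm0 addr0.
Qed.

Let tmapN p (u : tangent p) : tmap x (- u) = - tmap x u.
Proof. by rewrite -scaleN1r tmapZ scaleN1r. Qed.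

(** Transversality of [N] gives equality of the coefficients, then injectivity of [tmap] that of the
    tangent vectors. *)
Lemma rigging_direct N p (u v : tangent p) a b : null_rigging gb x N ->
  tmap x u + a *: N (x p) = tmap x v + b *: N (x p) -> u = v /\ a = b.
Proof.
move=> [_ /(_ p)[Np _ _]] E.
have {}E : tmap x (u - v) = (b - a) *: N (x p).
  rewrite -scaleN1r addrC tmap_linear// scaleN1r scalerBl.
  apply/eqP; rewrite addrC -subr_eq opprK.
  by apply/eqP; rewrite addrAC E addrC !addrA addNr add0r.
have ab : b - a = 0.
  apply/eqP/negP => /negP ab0; apply: Np; exists ((b - a)^-1 *: (u - v)).
  by rewrite tmapZ E scalerA mulVf// scale1r.
split; last by apply/esym/subr0_eq.
apply/subr0_eq/tmap_inj; rewrite E ab scale0r.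
by have := tmapZ 0 (u - v); rewrite !scale0r.
Qed.

Lemma rigging_span N p (z : tangent (x p)) : null_rigging gb x N ->
  exists (u : tangent p) a, z = tmap x u + a *: N (x p).
Proof.
move=> [_ /(_ p)[Np _ _]].
pose fM := GRing.isLinear.Build R 'rV[R]_n 'rV[R]_n.+1 _ (@tmap R n n.+1 M Mb x p)
  (fun a u v => tmap_linear a u v sx).
pose f : {linear 'rV[R]_n -> 'rV[R]_n.+1} := HB.pack (@tmap R n n.+1 M Mb x p) fM.
exact: (@hyperplane_span R n f _ z (@tmap_inj p) Np).
Qed.

Hypothesis hgb : semi_riemannian q gb.

Lemma metricZ p a (u v : tangent p) : gb p (a *: u) v = a * gb p u v.
Proof.
have g0 : gb p 0 v = 0.
  have := metric_linear hgb (-1) 0 0 v.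
  by rewrite scaler0 addr0 mulN1r addNr.
by have := metric_linear hgb a u 0 v; rewrite addr0 g0 addr0.
Qed.

Lemma metricZr p a (u v : tangent p) : gb p u (a *: v) = a * gb p u v.
Proof. by rewrite (Defs.metric_sym hgb) metricZ (Defs.metric_sym hgb). Qed.

(** Such a vector is orthogonal to [TM] and to [N], hence to the whole ambient tangent space;
    nondegeneracy makes it vanish. This gives uniqueness of the rigged field. *)
Lemma radical_eq0 N p (u : tangent p) : null_rigging gb x N ->
  radical gb x u -> gb (x p) (tmap x u) (N (x p)) = 0 -> u = 0.
Proof.
move=> hN ru uN; apply: tmap_inj.
have -> : tmap x (0 : tangent p) = 0 by have := tmapZ 0 u; rewrite !scale0r.
apply: (metric_nondegenerate hgb) => z; have [w [a ->]] := rigging_span z hN.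
rewrite (Defs.metric_sym hgb) addrC (metric_linear hgb).
rewrite !(Defs.metric_sym hgb _ (tmap x u)).
by rewrite uN mulr0 add0r; exact: ru.
Qed.

(** * Effect of the rescaling on the rigged field, the shape operators and the rotation form *)

Section Rescaling.
Variables (D : cov_op x) (N Nt : vector_field Mb).
Hypotheses (hD : connection_along D) (hN : null_rigging gb x N).
Variables (phi : M -> R^o).
Hypothesis hphi : smooth_on setT phi.
Hypothesis hNtN : forall p, Nt (x p) = (phi p : R) *: N (x p).
Variables (xi : vector_field M) (nab : @cov_op R n n M M id)
  (B : bilinear_field M) (AN As : forall p : M, tangent p -> tangent p)
  (tau : forall p : M, tangent p -> R).
Hypothesis hobj : rigging_objects gb D N xi nab B AN As tau.
Variables (xit : vector_field M) (nabt : @cov_op R n n M M id)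
  (Bt : bilinear_field M) (ANt Ast : forall p : M, tangent p -> tangent p)
  (taut : forall p : M, tangent p -> R).
Hypothesis hobjt : rigging_objects gb D Nt xit nabt Bt ANt Ast taut.

(** Homogeneity is inherited from [D]: it is read off the coefficient of [N] in the Weingarten
    formula. *)
Lemma rotation_formZ p a (v : tangent p) : tau (a *: v) = a * tau v.
Proof.
have D0 : D 0 (fun r => N (x r)) = 0 :> tangent (x p).
  have := conn_linear hD (-1) (0 : tangent p) 0 (fun r => N (x r)).
  by rewrite scaler0 addr0 scaleN1r addNr.
have := conn_linear hD a v 0 (fun r => N (x r)).
rewrite D0 !addr0 !(ro_weingarten hobj) -!tmapN scalerDr -tmapZ scalerA.
by case/(rigging_direct hN).
Qed.

Lemma rescaled_weingarten p (v : tangent p) :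
  ANt v = (phi p : R) *: AN v /\ (phi p : R) * taut v = ddir v phi + phi p * tau v.
Proof.
have [[U [oU xU sN]] _] := hN.
have sNx : smooth_along setT (fun r => N (x r)).
  have <- : x @^-1` U = setT by rewrite -subTset => r _; apply: xU; exists r.
  exact: smooth_along_comp.
have := conn_leibniz hD v openT I hphi sNx.
(* The relation between [Nt] and [N] holds along the hypersurface only, so the identity is one of
   sections along [x]. *)
have -> : (fun r => (phi r : R) *: N (x r)) = (fun r => Nt (x r)).
  by apply: functional_extensionality_dep => r; rewrite hNtN.
rewrite (ro_weingarten hobjt) (ro_weingarten hobj) hNtN.
rewrite -!tmapN scalerDr -tmapZ !scalerA addrCA -scalerDl.
case/(rigging_direct hN) => E1 E2; split; last by rewrite mulrC.
by apply: oppr_inj; rewrite E1 scalerN.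
Qed.

(** The difference is radical, and it is orthogonal to [N] because [phi * g(xit, N) = g(xit, Nt) = 1
    = g(xi, N)]. *)
Lemma rescaled_rigged_field p : xi p = (phi p : R) *: xit p.
Proof.
have [_ /(_ p)[rxi xiN]] := ro_rigged hobj.
have [_ /(_ p)[rxit xitN]] := ro_rigged hobjt.
apply: subr0_eq; apply: (radical_eq0 hN).
  move=> v; rewrite -scaleNr addrC.
  rewrite /induced_metric tmap_linear// (metric_linear hgb).
  by rewrite [gb _ _ _]rxit [gb _ _ _]rxi mulr0 addr0.
rewrite -scaleNr addrC tmap_linear// (metric_linear hgb) xiN.
by move: xitN; rewrite hNtN metricZr mulNr => ->; rewrite addNr.
Qed.

Lemma rescaled_shape p (v : tangent p) : As v = (phi p : R) *: Ast v.
Proof.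
have [sxi _] := ro_rigged hobj; have [sxit _] := ro_rigged hobjt.
have := ro_gauss hobj v openT I sxi.
have -> : (fun r => tmap x (xi r)) = (fun r => (phi r : R) *: tmap x (xit r)).
  apply: functional_extensionality_dep => r.
  by rewrite rescaled_rigged_field tmapZ.
rewrite (conn_leibniz hD v openT I hphi (smooth_along_tmap sx openT sxit)).
rewrite (ro_gauss hobjt v openT I sxit) hNtN scalerDr !scalerA -tmapZ addrA.
rewrite [X in X + _ = _]addrC -tmap_linear//.
(* The tangential part reads [nab_v xi = dphi(v) xit + phi nabt_v xit]; the transversal one,
   relating [B] and [Bt], is dropped. *)
case/(rigging_direct hN) => + _.
rewrite (ro_xi hobj) (ro_xi hobjt) rescaled_rigged_field.
have [_ E] := rescaled_weingarten v.
(* With [phi taut = dphi + phi tau], the terms [dphi(v) xit] cancel and [phi tau(v) xit] is common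
   to both sides. *)
rewrite scalerBr scalerN !scalerA E scalerDl opprD (mulrC (tau v)) addrA.
by rewrite addrAC subrK => /addIr/oppr_inj ->.
Qed.

End Rescaling.

End Rigging.

(** * Derivative of the rescaled factor, and the conclusion *)

Lemma ddir_div_sqr (R : realType) n (M : manifold R n) (f h : M -> R^o) p
    (v : tangent p) : smooth_on setT f -> smooth_on setT h -> h p != 0 ->
  ddir v (fun r => f r / h r ^+ 2 : R^o) =
  ddir v f / h p ^+ 2 - 2 * f p * ddir v h / h p ^+ 3.
Proof.
move=> sf sh h0; rewrite /ddir; set c := chart_at p.
have hK : bwd c (fwd c p) = p by rewrite fwdK//; exact: chart_at_dom.
have df : derivable (f \o bwd c : 'rV[R]_n -> R) (fwd c p) v.
  apply: diff_derivable; apply: (smooth_on_differentiable sf) => //.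
    exact: chart_at_atlas.
  exact: chart_at_dom.
have dh : derivable (h \o bwd c : 'rV[R]_n -> R) (fwd c p) v.
  apply: diff_derivable; apply: (smooth_on_differentiable sh) => //.
    exact: chart_at_atlas.
  exact: chart_at_dom.
have hX0 : ((h \o bwd c : 'rV[R]_n -> R) ^+ 2) (fwd c p) != 0.
  by rewrite fctE /= hK expf_neq0.
pose F := f \o bwd c : 'rV[R]_n -> R; pose H := h \o bwd c : 'rV[R]_n -> R.
have -> : (fun r => f r / h r ^+ 2 : R^o) \o bwd c = F * (fun a => ((H ^+ 2) a)^-1).
  by apply/funext => a.
have dX : derivable (H ^+ 2) (fwd c p) v by exact: derivableX.
rewrite (deriveM df (derivableV hX0 dX)).
rewrite (deriveV hX0 dX) deriveX// !fctE /= hK.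
have alg (a b d e : R) : b != 0 ->
    a * (- b ^+ 2 ^- 2 * (2 * b ^+ 1 * d)) + b ^- 2 * e =
    e / b ^+ 2 - 2 * a * d / b ^+ 3.
  by move=> b0; field.
exact: alg.
Qed.

Theorem proposition3p3 (R : realType) (n q : nat)
  (Mb : manifold R n.+1) (gb : bilinear_field Mb)
  (hq : (0 < q)%N) (hgb : semi_riemannian q gb)
  (nabb : @cov_op R n.+1 n.+1 Mb Mb id) (hnabb : levi_civita gb nabb)
  (M : manifold R n) (x : M -> Mb) (hM : null_hypersurface gb x)
  (D : cov_op x) (hD : pullback_connection nabb D)
  (N : vector_field Mb) (hN : null_rigging gb x N)
  (hclosed : closed_rigging gb x N)
  (xi : vector_field M) (nab : @cov_op R n n M M id) (B : bilinear_field M)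
  (AN As : forall p : M, tangent p -> tangent p)
  (tau : forall p : M, tangent p -> R)
  (hobj : rigging_objects gb D N xi nab B AN As tau)
  (alpha : M -> R^o) (halpha : smooth_on setT alpha)
  (halpha0 : forall p, alpha p != 0)
  (hAs : forall p (v : tangent p), As p v = (alpha p : R) *: AN p v)
  (htau : forall p, 2 * alpha p * tau p (xi p) + ddir (xi p) alpha = 0)
  (phi : M -> R^o) (hphi : smooth_on setT phi)
  (hphi0 : forall p, phi p != 0)
  (hphileaf : forall F, leaf (screen gb x N) F ->
     forall p r, F p -> F r -> phi p = phi r)
  (Nt : vector_field Mb) (hNt : null_rigging gb x Nt)
  (hNtN : forall p, Nt (x p) = (phi p : R) *: N (x p))
  (xit : vector_field M) (nabt : @cov_op R n n M M id) (Bt : bilinear_field M)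
  (ANt Ast : forall p : M, tangent p -> tangent p)
  (taut : forall p : M, tangent p -> R)
  (hobjt : rigging_objects gb D Nt xit nabt Bt ANt Ast taut) :
  let alphat : M -> R^o := fun p => alpha p / phi p ^+ 2 in
  (forall p (v : tangent p), Ast p v = (alphat p : R) *: ANt p v) /\
  (forall p, 2 * alphat p * taut p (xit p) + ddir (xit p) alphat = 0).
Proof.
move=> alphat.
have hDc : connection_along D by case: hD.
have W := rescaled_weingarten hM hDc hN hphi hNtN hobj hobjt.
split=> [p v|p].
  have [-> _] := W p v.
  have := rescaled_shape hM hgb hDc hN hphi hNtN hobj hobjt v.
  (* The relation is now [alpha A_N = phi Ast]; division by [phi] gives [Ast], to be compared with
     [alphat * phi * A_N]. *)
  rewrite hAs => /(congr1 (fun u => (phi p)^-1 *: u)).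
  rewrite !scalerA mulVf// scale1r => <-.
  congr (_ *: _); rewrite /alphat; field.
  exact: hphi0.
have [_ E] := W p (xit p).
have Xi := rescaled_rigged_field hM hgb hN hNtN hobj hobjt p.
have := htau p; rewrite Xi (rotation_formZ hM hDc hN hobj).
have -> : ddir ((phi p : R) *: xit p) alpha = phi p * ddir (xit p) alpha.
  have := ddir_linear (phi p) (xit p) 0 halpha (I : setT p).
  by rewrite !addr0 {3}/ddir derive0 addr0.
(* Here [a], [b] are [alpha], [phi]; [d], [e] the derivatives of [phi], [alpha] along [xit]; [s],
   [t] the values of [tau], [taut] on [xit]. *)
have alg (a b d e s t : R) : b != 0 -> b * t = d + b * s ->
    2 * a * (b * s) + b * e = 0 ->
    2 * (a / b ^+ 2) * t + (e / b ^+ 2 - 2 * a * d / b ^+ 3) = 0.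
  move=> b0 E1 E2; have -> : d = b * t - b * s by rewrite E1 addrK.
  have -> : e = - (2 * a * s).
    by apply: (mulfI b0); apply/eqP; rewrite -subr_eq0 -E2; apply/eqP; ring.
  by field.
rewrite (ddir_div_sqr _ halpha hphi (hphi0 p)) => H.
exact: alg (hphi0 p) E H.
Qed.
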